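(* The sequence $(\mathcal{P}_n)_{n\ge 0}$ giving the $2$-abelian complexity of the Thue--Morse word $t$ is $2$-regular.
   Context: The infinite Thue--Morse word is $t=\lim_{n\to\infty} m^n(0)=0110100110010110\cdots$, where $m$ is the morphism $0\mapsto 01$, $1\mapsto 10$. $T_n$ denotes the set of (finite, contiguous) factors of $t$ of length $n$. For words $u,v$, $|u|_v$ is the number of occurrences of $v$ as a factor of $u$. Two words $u,v\in\{0,1\}^*$ are $2$-abelian equivalent, $u\equiv_2 v$, if their prefixes of length $1$ agree, their suffixes of length $1$ agree, and $|u|_w=|v|_w$ for every word $w$ of length $2$. (The empty word forms its own class.) $\mathcal{P}_n:=\#(T_n/{\equiv_2})$ is the number of $2$-abelian equivalence classes of factors of $t$ of length $n$; the sequence starts $1,2,4,6,8,6,8,10,8,6,\dots$. For an integer $k\ge 2$, the $k$-kernel of a sequence $(a(n))_{n\ge 0}$ is the set of subsequences $\{(a(k^e n+c))_{n\ge 0} \mid e\ge 0,\ 0\le c<k^e\}$. An integer sequence is $k$-regular if the $\mathbb{Z}$-module generated by its $k$-kernel is finitely generated. *)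

(* Defs.v *)
From mathcomp Require Import all_boot all_order all_algebra.
From mathcomp Require Import boolp classical_sets functions cardinality.

Set Implicit Arguments.
Unset Strict Implicit.
Unset Printing Implicit Defensive.

Import GRing.Theory.

(* The letters 0 and 1 are encoded as false and true. *)

Definition tm_letter (b : bool) : seq bool := [:: b; ~~ b].

Definition tm_morphism (w : seq bool) : seq bool := flatten (map tm_letter w).

(* m^n(0) has length 2^n > n and is a prefix of m^(n+1)(0), so the n-th letter
   of the limit word is the n-th letter of m^n(0); see thue_morse_limit. *)
Definition thue_morse (n : nat) : bool :=
  nth false (iter n tm_morphism [:: false]) n.

Lemma size_tm_morphism w : size (tm_morphism w) = (size w).*2.
Proof. by elim: w => //= a w; rewrite /tm_morphism /= => ->. Qed.

Lemma size_iter_tm n : size (iter n tm_morphism [:: false]) = 2 ^ n.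
Proof. by elim: n => //= n IH; rewrite size_tm_morphism IH expnS mul2n. Qed.

Lemma tm_morphism_cat u v :
  tm_morphism (u ++ v) = tm_morphism u ++ tm_morphism v.
Proof. by rewrite /tm_morphism map_cat flatten_cat. Qed.

Lemma prefix_iter_tm k n :
  prefix (iter k tm_morphism [:: false]) (iter (n + k) tm_morphism [:: false]).
Proof.
elim: n => [|n IH]; first exact: prefix_refl.
apply: prefix_trans IH _; rewrite addSn; move: (n + k) => {n}m.
elim: m => //= m /prefixP[w E].
by rewrite {2}E tm_morphism_cat prefix_prefix.
Qed.

Lemma thue_morse_limit n i : i < 2 ^ n ->
  nth false (iter n tm_morphism [:: false]) i = thue_morse i.
Proof.
have nthP k l : k <= l -> i < 2 ^ k ->
    nth false (iter k tm_morphism [:: false]) i =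
    nth false (iter l tm_morphism [:: false]) i.
  move=> le_kl ltik; have /prefixP[w] := prefix_iter_tm k (l - k).
  by rewrite subnK // => ->; rewrite nth_cat size_iter_tm ltik.
move=> lt_i; rewrite /thue_morse; case: (leqP n i) => [le|/ltnW le].
  exact: nthP.
by apply/esym/nthP => //; apply: ltn_expl.
Qed.

Definition is_factor (t : nat -> bool) (u : seq bool) : Prop :=
  exists i : nat, u = mkseq (fun j => t (i + j)) (size u).

Definition factors (t : nat -> bool) (n : nat) : {set n.-tuple bool} :=
  [set u : n.-tuple bool | `[< is_factor t u >]]%SET.

(* Number of (possibly overlapping) occurrences of v in u. *)
Definition occ (u v : seq bool) : nat :=
  count (fun i => prefix v (drop i u)) (iota 0 (size u).+1).

Definition abelian2_eq (u v : seq bool) : bool :=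
  [&& take 1 u == take 1 v,
      drop (size u - 1) u == drop (size v - 1) v &
      [forall w : 2.-tuple bool, occ u w == occ v w]].

Lemma abelian2_eq_equiv (D : {pred seq bool}) :
  {in D & &, equivalence_rel abelian2_eq}.
Proof.
move=> u v w _ _ _; rewrite /abelian2_eq !eqxx; split.
  by apply/forallP => x; rewrite eqxx.
case/and3P=> /eqP-> /eqP-> /forallP E; congr [&& _, _ & _].
by apply: eq_forallb => x; rewrite (eqP (E x)).
Qed.

Definition abelian2_complexity (t : nat -> bool) (n : nat) : nat :=
  #|equivalence_partition (fun u v : n.-tuple bool => abelian2_eq u v)
      (factors t n)|.

Local Open Scope classical_set_scope.

Definition kernel (k : nat) (a : nat -> int) : set (nat -> int) :=
  [set b | exists e c : nat, c < k ^ e /\ b = (fun n => a (k ^ e * n + c))].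

(* Z-submodules are the same as additive subgroups; sequences are added
   pointwise. *)
Definition zmod_generated (V : zmodType) (G : set V) : set V :=
  smallest [set A : set V | zmod_closed (fun x => x \in A)] G.

Definition finitely_generated (V : zmodType) (M : set V) : Prop :=
  exists2 B : set V, finite_set B & M = zmod_generated B.

Definition regular (k : nat) (a : nat -> int) : Prop :=
  finitely_generated (zmod_generated (kernel k a)).

(* Main.v *)
Require Import Defs.
From mathcomp Require Import all_boot all_order all_algebra.
From mathcomp Require Import boolp classical_sets functions cardinality.
From mathcomp Require Import zify.

Set Implicit Arguments.
Unset Strict Implicit.
Unset Printing Implicit Defensive.

Import GRing.Theory.

(** Among the nonempty words of a given length, the 2-abelian class of a word is
    determined by its first letter, its number [c] of changes (positions where
    two consecutive letters differ) and its number of ones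
    (abelian2_eq_signature).

    The Thue--Morse word is a concatenation of blocks 01 and 10, so a factor
    that consists of whole blocks is balanced; hence the number of ones of the
    factor of length N+1 at position i depends only on N, on its end letters
    and on the parity of i, and that parity matters only when c + N is odd
    (ones_class, ones_of_class_inj). Every factor occurs also complemented,
    at positions of the same parity, so the first letter is free. Therefore
    the complexity at N+1 is twice the number of values c with c + N even,
    plus twice the number of values c with c + N odd attained at even
    positions, plus twice the same number for odd positions
    (complexity_count).

    The numbers of changes follow the period-doubling recurrence: positions 2i
    carry a change, positions 2i+1 carry a change iff i does not. So the values
    attained on windows of length 2N or 2N+1 are the reflections of those for
    N and N+1, and by induction they fill an interval [lo N, hi N]
    (range_exists) whose ends satisfy affine recurrences. Counting the even and
    odd points of an interval involves only its length and the parities of its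
    ends, and these parities satisfy affine recurrences as well. Consequently
    the complexity is an integral affine expression in finitely many sequences
    which are exchanged, up to constants, by n -> 2n and n -> 2n+1.

    It remains to produce generators of the module spanned by the 2-kernel.
    Twelve kernel elements suffice: each of their further decimations at 2n and
    2n+1 is again one of them or an integral combination of them, and each of
    these thirteen linear relations is checked with the recurrences. *)

(** * The Thue--Morse word and its windows *)

Lemma nth_tm_morphism w i : i < size w ->
  nth false (tm_morphism w) i.*2 = nth false w i /\
  nth false (tm_morphism w) i.*2.+1 = ~~ nth false w i.
Proof. by elim: w i => //= x w IHw [|i] //= /IHw. Qed.

Lemma thue_morse_double_and n :
  thue_morse n.*2 = thue_morse n /\ thue_morse n.*2.+1 = ~~ thue_morse n.
Proof.
have lt_n : n < 2 ^ n by exact: ltn_expl.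
have [t0 t1] := @nth_tm_morphism (iter n tm_morphism [:: false]) n
  ltac:(by rewrite size_iter_tm).
rewrite -(thue_morse_limit lt_n) -t1 -t0 -iterS;
  split; apply/esym/thue_morse_limit;
  rewrite expnS; lia.
Qed.

Lemma thue_morse_double n : thue_morse n.*2 = thue_morse n.
Proof. by have [] := thue_morse_double_and n. Qed.

Lemma thue_morse_doubleS n : thue_morse n.*2.+1 = ~~ thue_morse n.
Proof. by have [] := thue_morse_double_and n. Qed.

Lemma parity_split n : (exists m, n = m.*2) \/ (exists m, n = m.*2.+1).
Proof.
by rewrite -(odd_double_half n); case: (odd n); [right|left]; exists n./2.
Qed.

(** Complementary copies: the second half of m^(k+1)(0) is the complement of
    its first half. *)
Lemma thue_morse_shift k i : i < 2 ^ k ->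
  thue_morse (2 ^ k + i) = ~~ thue_morse i.
Proof.
elim: k i => [|k IHk] i; first by case: i.
rewrite expnS mul2n => lt_i.
have [[j def_i]|[j def_i]] := parity_split i; rewrite def_i in lt_i *.
  by rewrite -doubleD !thue_morse_double IHk //; lia.
by rewrite addnS -doubleD !thue_morse_doubleS IHk //; lia.
Qed.

(** The period-doubling word. *)
Definition change i : bool := thue_morse i (+) thue_morse i.+1.

Lemma change_double i : change i.*2.
Proof. by rewrite /change thue_morse_double thue_morse_doubleS addbN addbb. Qed.

Lemma change_doubleS i : change i.*2.+1 = ~~ change i.
Proof.
by rewrite /change thue_morse_doubleS -doubleS thue_morse_double addNb.
Qed.

Definition changes i n : nat := \sum_(j < n) change (i + j).
Definition ones i n : nat := \sum_(j < n) thue_morse (i + j).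

Lemma changes0 i : changes i 0 = 0.
Proof. by rewrite /changes big_ord0. Qed.

Lemma changesS i n : changes i n.+1 = changes i n + change (i + n).
Proof. by rewrite /changes big_ord_recr. Qed.

Lemma onesS i n : ones i n.+1 = ones i n + thue_morse (i + n).
Proof. by rewrite /ones big_ord_recr. Qed.

Lemma ones_recl i n : ones i n.+1 = thue_morse i + ones i.+1 n.
Proof.
rewrite /ones big_ord_recl addn0; congr (_ + _).
by apply: eq_bigr => j _; rewrite addSnnS.
Qed.

Lemma changes_recl i n : changes i n.+1 = change i + changes i.+1 n.
Proof.
rewrite /changes big_ord_recl addn0; congr (_ + _).
by apply: eq_bigr => j _; rewrite addSnnS.
Qed.

(** In the four reflections below, every even position of the left window
    carries a change, and its odd positions 2j+1, where the indices j run over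
    the right window, carry one iff j does not. Hence the two numbers add up to
    the length of the left window. *)
Lemma changes_double i n : changes i.*2 n.*2 + changes i n = n.*2.
Proof.
elim: n => [|n IHn]; first by rewrite !changes0.
rewrite doubleS !changesS addnS -doubleD change_double change_doubleS.
by case: (change _); lia.
Qed.

Lemma changes_doubleS i n : changes i.*2.+1 n.*2 + changes i n = n.*2.
Proof.
elim: n => [|n IHn]; first by rewrite !changes0.
rewrite doubleS !changesS addnS addSn -doubleD -doubleS change_double.
by rewrite change_doubleS; case: (change _); lia.
Qed.

Lemma changes_double_odd i n : changes i.*2 n.*2.+1 + changes i n = n.*2.+1.
Proof.
by have := changes_double i n; rewrite changesS -doubleD change_double; lia.
Qed.

Lemma changes_doubleS_odd i n :
  changes i.*2.+1 n.*2.+1 + changes i n.+1 = n.*2.+1.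
Proof.
have := changes_doubleS i n; rewrite !changesS addSn -doubleD change_doubleS.
by case: (change _); lia.
Qed.

(** The first letter and the number of changes determine the last letter. *)
Lemma thue_morse_changes i n :
  thue_morse (i + n) = thue_morse i (+) odd (changes i n).
Proof.
elim: n => [|n IHn]; first by rewrite changes0 addn0 addbF.
rewrite changesS oddD addbA -IHn oddb /change addbA addbb addnS.
by case: (thue_morse _.+1).
Qed.

Lemma ones_double i n : ones i.*2 n.*2 = n.
Proof.
elim: n => [|n IHn]; first by rewrite /ones big_ord0.
rewrite doubleS !onesS IHn addnS -doubleD thue_morse_double thue_morse_doubleS.
by case: (thue_morse _); lia.
Qed.

(** The number of ones in a window of length N+1 with first letter [a] and [c]
    changes; [q] tells whether the window starts inside a block, which splits
    off the first letter and moves the block boundaries at the other end. *)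
Definition ones_of_class N (a : bool) c (q : bool) : nat :=
  let b := a (+) odd c in
  N./2 + (if odd N then if q then a + b else 1 else if q then a else b).

(** If c + N is even, both starting parities give the same number of ones:
    the end letters then agree for even N and differ for odd N. This allows
    the bit [odd i] to be replaced by [odd i && odd (c + N)], which is a
    function of the word. *)
Lemma ones_class i N : let c := changes i N in
  ones i N.+1 = ones_of_class N (thue_morse i) c (odd i && odd (c + N)).
Proof.
move=> c; rewrite /ones_of_class -thue_morse_changes.
have last_c : odd c = thue_morse i (+) thue_morse (i + N).
  by rewrite thue_morse_changes addKb.
rewrite oddD last_c.
have [[k def_N]|[k def_N]] := parity_split N; rewrite def_N {c last_c}.
  rewrite odd_double doubleK addbF.
  have [[j ->]|[j ->]] := parity_split i.
    by rewrite odd_double onesS ones_double.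
  rewrite /= odd_double /=.
  have := ones_recl j.*2 k.*2.+1.
  rewrite -doubleS ones_double thue_morse_double thue_morse_doubleS.
  rewrite addSn -doubleD thue_morse_doubleS.
  by case: (thue_morse j); case: (thue_morse (j + k)) => /=; lia.
rewrite /= odd_double /= uphalf_double addbT.
have [[j ->]|[j ->]] := parity_split i.
  by rewrite odd_double -doubleS ones_double /= addn1.
rewrite /= odd_double /= addSnnS -doubleS -doubleD thue_morse_double.
have := ones_recl j.*2 k.+1.*2.
rewrite onesS ones_double -doubleD !thue_morse_double thue_morse_doubleS.
by case: (thue_morse j); case: (thue_morse (j + k.+1)) => /=; lia.
Qed.

(** * Signatures of words *)

Lemma occ_short x v : 1 < size v -> occ [:: x] v = 0.
Proof. by case: v => [|y [|z v]] //; rewrite /occ /= andbF. Qed.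

Lemma occ_cons2 x y s a b :
  occ [:: x, y & s] [:: a; b] =
  ((a == x) && (b == y)) + occ (y :: s) [:: a; b].
Proof.
have -> : occ [:: x, y & s] [:: a; b] = prefix [:: a; b] [:: x, y & s]
    + count (fun i => prefix [:: a; b] (drop i [:: x, y & s]))
        (iota (1 + 0) (size s).+2) by [].
by rewrite iotaDl count_map /= prefix0s andbT.
Qed.

Definition word_changes u :=
  occ u [:: false; true] + occ u [:: true; false].

(** The changes 01 and 10 alternate, so their numbers differ only through the
    end letters; each one after the first letter ends an occurrence of 01 or
    11; and a word has one occurrence of a two-letter word at each position but
    the last. *)
Lemma word_counts (x : bool) s :
  [/\ x + occ (x :: s) [:: false; true]
        = last x s + occ (x :: s) [:: true; false],
      count id (x :: s)
        = x + occ (x :: s) [:: false; true] + occ (x :: s) [:: true; true] &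
      occ (x :: s) [:: false; false] + occ (x :: s) [:: true; true]
        + word_changes (x :: s) = size s].
Proof.
rewrite /word_changes.
elim: s x => [|y s IHs] x; first by rewrite !occ_short //=; case: x.
have [] := IHs y; rewrite !occ_cons2 /=.
by case: x; case: y => /= *; split; lia.
Qed.

Lemma drop_last (x : bool) s :
  drop (size (x :: s) - 1) (x :: s) = [:: last x s].
Proof. by rewrite subn1 lastI size_rcons -cats1 drop_size_cat. Qed.

Definition signature u := (head false u, word_changes u, count id u).

(** Given the first letter, the parity of the number of changes yields the last
    letter, then the number of changes yields the numbers of 01 and 10, the
    number of ones yields that of 11, and the length that of 00. *)
Lemma abelian2_eq_signature u v : 0 < size u -> size u = size v ->
  abelian2_eq u v = (signature u == signature v).
Proof.
case: u v => [|x s] [|y r] // _ [eq_sz]; rewrite /abelian2_eq !drop_last.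
have [u1 u2 u3] := word_counts x s; have [v1 v2 v3] := word_counts y r.
rewrite /signature !xpair_eqE; apply/and3P/andP.
  case=> /eqP[eq_x] _ _ occ_eq; subst y; rewrite eqxx u2 v2.
  have {}occE a b : occ (x :: s) [:: a; b] = occ (x :: r) [:: a; b].
    by have /forallP/(_ [tuple a; b])/eqP := occ_eq.
  by rewrite /word_changes !occE !eqxx.
case=> /andP[/eqP/= eq_x /eqP eq_c] /eqP eq_o; subst y.
have eq_last : last x s = last x r.
  move: u1 v1 eq_c; rewrite /word_changes.
  by case: (last x s); case: (last x r) => //=; lia.
split; rewrite ?eq_last //; first by rewrite /= !take0.
apply/forallP => w; rewrite eq_last in u1.
have {}eq_o : count id (x :: s) = count id (x :: r) by [].
rewrite u2 v2 in eq_o; move: eq_c; rewrite /word_changes => eq_c.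
rewrite /word_changes in u3 v3.
by case/tupleP: w => a w; case/tupleP: w => b w; rewrite (tuple0 w) /=;
   case: a; case: b; lia.
Qed.

Definition window i n := mkseq (fun j => thue_morse (i + j)) n.

Lemma window_recl i n : window i n.+1 = thue_morse i :: window i.+1 n.
Proof.
rewrite /window /mkseq /= addn0; congr (_ :: _).
by rewrite -[1]/(1 + 0) iotaDl -map_comp; apply: eq_map => j /=; rewrite addnCA.
Qed.

Lemma word_changes_window i n : word_changes (window i n.+1) = changes i n.
Proof.
elim: n i => [|n IHn] i.
  by rewrite changes0 /word_changes !window_recl !occ_short.
rewrite changes_recl -IHn {1}/word_changes window_recl window_recl.
rewrite !occ_cons2 -window_recl /change.
rewrite /word_changes.
by case: (thue_morse i); case: (thue_morse i.+1) => /=; lia.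
Qed.

Lemma count_window i n : count id (window i n) = ones i n.
Proof.
elim: n i => [|n IHn] i; first by rewrite /ones big_ord0.
by rewrite ones_recl window_recl /= IHn.
Qed.

Lemma signature_window i N : let c := changes i N in
  signature (window i N.+1) = (thue_morse i, c,
    ones_of_class N (thue_morse i) c (odd i && odd (c + N))).
Proof.
by rewrite /signature word_changes_window count_window ones_class window_recl.
Qed.

(** A shift by a large power of 2 complements a window, and preserves its
    changes and the parity of its position. *)
Lemma window_complement i N a : exists2 j,
  thue_morse j = a & odd j = odd i /\ changes j N = changes i N.
Proof.
have [eq_a|neq_a] := eqVneq (thue_morse i) a; first by exists i.
pose k := (i + N).+1; have lt_k : k < 2 ^ k by apply: ltn_expl.
exists (2 ^ k + i).
  rewrite thue_morse_shift; last by rewrite /k in lt_k *; lia.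
  by case: a neq_a; case: (thue_morse i).
split; first by rewrite oddD oddX.
apply: eq_bigr => j _; rewrite /change -addnA -addnS.
have lt_j := ltn_ord j; rewrite /k in lt_k *.
by rewrite !thue_morse_shift ?addNb ?addbN ?negbK //; lia.
Qed.

(** * Counting the classes *)

(** The invariant [f] may take values in an infinite type, as signatures do; a
    list of the values that it attains then replaces the image set. *)
Lemma card_equivalence_partition_seq (T : finType) (U : eqType) (R : rel T)
    (D : {set T}) (f : T -> U) (s : seq U) :
  {in D &, forall x y, R x y = (f x == f y)} -> uniq s ->
  (forall y, y \in s <-> exists2 x, x \in D & f x = y) ->
  #|equivalence_partition R D| = size s.
Proof.
move=> R_f uniq_s mem_s; pose fiber y := [set x in D | f x == y]%SET.
have fiber_inj : {in s &, injective fiber}.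
  move=> y z /mem_s[x Dx <-] _ /setP/(_ x); rewrite !inE Dx eqxx /=.
  by move/esym/eqP.
rewrite -(size_map fiber) -(card_uniqP _) ?map_inj_in_uniq //.
apply: eq_card => B; apply/imsetP/mapP => [[x Dx ->]|[y /mem_s[x Dx <-] ->]].
  exists (f x); first by apply/mem_s; exists x.
  apply/setP => z; rewrite !inE.
  by case Dz: (z \in D); rewrite //= R_f // eq_sym.
exists x => //.
apply/setP => z; rewrite !inE.
by case Dz: (z \in D); rewrite //= R_f // eq_sym.
Qed.

Lemma factorsP n (u : n.-tuple bool) :
  u \in factors thue_morse n <-> exists i, window i n = u.
Proof.
rewrite inE; split=> [/asboolP[i def_u]|[i def_u]].
  by exists i; rewrite def_u size_tuple.
by apply/asboolP; exists i; rewrite size_tuple -def_u.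
Qed.

(** Codes of the classes with a fixed first letter: the number of changes,
    with the bit of [ones_class]. The lists [A], [E] and [O] are meant to hold
    the numbers of changes attained at all, at even and at odd positions. *)
Definition class_pairs N (A E O : seq nat) : seq (nat * bool) :=
  [seq (c, false) | c <- A & ~~ odd (c + N)] ++
  [seq (c, false) | c <- E & odd (c + N)] ++
  [seq (c, true) | c <- O & odd (c + N)].

Lemma ones_of_class_inj N a c : odd (c + N) -> injective (ones_of_class N a c).
Proof.
rewrite oddD /ones_of_class => odd_cN q r.
by case: (odd N) odd_cN; case: (odd c); case: a; case: q; case: r => //=; lia.
Qed.

Lemma class_pairs_uniq N (A E O : seq nat) :
  uniq A -> uniq E -> uniq O -> uniq (class_pairs N A E O).
Proof.
move=> uA uE uO; rewrite !cat_uniq.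
rewrite !map_inj_uniq ?filter_uniq //=; try by move=> c d [].
rewrite ?andbT; apply/andP; split=> //.
  rewrite has_cat negb_or; apply/andP; split; apply/hasPn => p.
    case/mapP=> c; rewrite mem_filter => /andP[cN _] ->.
    apply/negP => /mapP[d]; rewrite mem_filter => /andP[dN _] [eq_cd].
    by rewrite eq_cd (negPf dN) in cN.
  by case/mapP=> c _ ->; apply/negP => /mapP[].
by apply/hasPn => p /mapP[c _ ->]; apply/negP => /mapP[].
Qed.

(** By [ones_class] the signature of a factor is a function of its first letter
    and its code, injective by [ones_of_class_inj]; by [window_complement] each
    code occurs with both first letters, which gives the factor 2. *)
Lemma complexity_count N (A E O : seq nat) :
  uniq A -> uniq E -> uniq O ->
  (forall c, c \in A <-> exists i, changes i N = c) ->
  (forall c, c \in E <-> exists i, changes i.*2 N = c) ->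
  (forall c, c \in O <-> exists i, changes i.*2.+1 N = c) ->
  abelian2_complexity thue_morse N.+1 =
  2 * (count (fun c => ~~ odd (c + N)) A +
       (count (fun c => odd (c + N)) E + count (fun c => odd (c + N)) O)).
Proof.
move=> uA uE uO AP EP OP; pose Q := class_pairs N A E O.
have QP c q : (c, q) \in Q <->
    exists2 i, changes i N = c & q = odd i && odd (c + N).
  rewrite !mem_cat; split.
    case/or3P=> /mapP[d]; rewrite mem_filter => /andP[cN] Sd [-> ->].
    - by have /AP[i def_d] := Sd; exists i; rewrite // (negPf cN) andbF.
    - by have /EP[i def_d] := Sd; exists i.*2; rewrite // odd_double.
    - by have /OP[i def_d] := Sd; exists i.*2.+1; rewrite // cN /= odd_double.
  case=> i <- ->; apply/or3P.
  have [cN|cN] := boolP (odd (changes i N + N)); last first.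
    rewrite andbF; apply/Or31/mapP; exists (changes i N) => //.
    by rewrite mem_filter cN; apply/AP; exists i.
  rewrite andbT; have [[j def_i]|[j def_i]] := parity_split i.
    rewrite def_i odd_double -def_i.
    apply/Or32/mapP; exists (changes i N) => //.
    by rewrite mem_filter cN; apply/EP; exists j; rewrite def_i.
  rewrite def_i /= odd_double -def_i.
  apply/Or33/mapP; exists (changes i N) => //.
  by rewrite mem_filter cN; apply/OP; exists j; rewrite def_i.
pose sig a (p : nat * bool) := (a, p.1, ones_of_class N a p.1 p.2).
pose S := [seq sig a p | a <- [:: false; true], p <- Q].
transitivity (size S); last first.
  by rewrite size_allpairs !size_cat !size_map !size_filter.
apply: (@card_equivalence_partition_seq _ _ _ _
  (fun u : N.+1.-tuple bool => signature u)).
- by move=> u v _ _; rewrite abelian2_eq_signature ?size_tuple.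
- apply: allpairs_uniq => //; first exact: class_pairs_uniq.
  move=> _ _ /allpairsP[[a [c q]] [_ Qp ->]] /allpairsP[[b [d r]] [_ Qq ->]].
  rewrite /= in Qp Qq.
  rewrite /sig /= => -[<- eq_cd]; rewrite -{}eq_cd in Qq *.
  have [i _ ->] := (QP _ _).1 Qp; have [j _ ->] := (QP _ _).1 Qq.
  have [cN|_] := boolP (odd (c + N)); last by rewrite !andbF.
  by move/(ones_of_class_inj cN) ->.
- move=> y; split.
    case/allpairsP=> [[a [c q]] [_ /QP[i def_c def_q] ->]].
    have [j tj [odd_j changes_j]] := window_complement i N a.
    have sz_w : size (window j N.+1) == N.+1 by rewrite size_mkseq.
    exists (Tuple sz_w); first by apply/factorsP; exists j.
    by rewrite /= signature_window tj changes_j odd_j def_c -def_q.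
  case=> u /factorsP[i <-] <-; rewrite signature_window.
  apply/allpairsP; exists (thue_morse i,
    (changes i N, odd i && odd (changes i N + N))).
  by split; rewrite //=; [case: (thue_morse i)|apply/QP; exists i].
Qed.

(** * The range of the number of changes *)

Definition attained N c := exists i, changes i N = c.

Lemma attained_parity N c : attained N c <->
  (exists i, changes i.*2 N = c) \/ (exists i, changes i.*2.+1 N = c).
Proof.
split=> [[i <-]|[] [i <-]]; [|by eexists..].
by have [[j ->]|[j ->]] := parity_split i; [left|right]; exists j.
Qed.

Lemma attainedS_le N c : attained N.+1 c ->
  exists2 d, attained N d & d <= c <= d.+1.
Proof.
case=> i <-; exists (changes i N); first by exists i.
by rewrite changesS; case: (change _); lia.
Qed.

Lemma attained_leS N c : attained N c ->
  exists2 d, attained N.+1 d & c <= d <= c.+1.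
Proof.
case=> i <-; exists (changes i N.+1); first by exists i.
by rewrite changesS; case: (change _); lia.
Qed.

Definition is_range N (b : nat * nat) :=
  b.1 <= b.2 /\ forall c, attained N c <-> b.1 <= c <= b.2.

(** Extending a window by one letter adds 0 or 1 to its changes, hence the ends
    of the range move up by 0 or 1. So the ranges for N and N+1 overlap or are
    adjacent, and their union is an interval. *)
Lemma range_step N b b' : is_range N b -> is_range N.+1 b' ->
  b.1 <= b'.1 <= b.1.+1 /\ b.2 <= b'.2 <= b.2.+1.
Proof.
move=> [le_b bP] [le_b' bP'].
have [|d /bP] := @attainedS_le N b'.1; first by apply/bP'; lia.
have [|d2 /bP] := @attainedS_le N b'.2; first by apply/bP'; lia.
have [|d3 /bP'] := @attained_leS N b.1; first by apply/bP; lia.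
have [|d4 /bP'] := @attained_leS N b.2; first by apply/bP; lia.
lia.
Qed.

Lemma range_le N b : is_range N b -> b.2 <= N.
Proof.
case=> le_b bP; have [|i <-] := (bP b.2).2; first lia.
elim: N {bP} => [|N IHN]; first by rewrite changes0.
by rewrite changesS; case: (change _); lia.
Qed.

(** The reflected ranges, for windows at positions of a given parity: [f i] is
    the number of changes of the window attached to [i]. *)
Lemma range_complement N b M (f : nat -> nat) : is_range N b ->
  (forall i, f i + changes i N = M) ->
  b.2 <= M /\ forall c, (exists i, f i = c) <-> M - b.2 <= c <= M - b.1.
Proof.
move=> [le_b bP] fM.
have [|i0 def_i0] := (bP b.2).2; first lia.
have le_M : b.2 <= M by have := fM i0; lia.
split=> // c; split=> [[i <-]|le_c].
  have := fM i; have/bP : attained N (changes i N) by exists i.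
  lia.
have [|i def_i] := (bP (M - c)).2; first lia.
by exists i; have := fM i; lia.
Qed.

Lemma range_double N b : is_range N b ->
  is_range N.*2 (N.*2 - b.2, N.*2 - b.1).
Proof.
move=> bP; split=> [|c] /=; first by have := range_le bP; case: bP; lia.
rewrite attained_parity.
rewrite (range_complement bP (changes_double ^~ N)).2.
by rewrite (range_complement bP (changes_doubleS ^~ N)).2; tauto.
Qed.

Lemma range_doubleS N b b' : is_range N b -> is_range N.+1 b' ->
  is_range N.*2.+1 (N.*2.+1 - b'.2, N.*2.+1 - b.1).
Proof.
move=> bP bP'; have step := range_step bP bP'.
have [le_b _] := bP; have [le_b' _] := bP'.
have [le_bM evenP] := range_complement bP (changes_double_odd ^~ N).
have [le_bM' oddP] := range_complement bP' (changes_doubleS_odd ^~ N).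
split=> [|c] /=; first by lia.
by rewrite attained_parity evenP oddP; split; [case|]; lia.
Qed.

(** The values 0 and 1 of N start the induction: halving 1 would refer to the
    range for 1 itself. *)
Lemma range_exists N : exists b, is_range N b.
Proof.
elim/ltn_ind: N => N IHN; have [[k def_N]|[k def_N]] := parity_split N.
  case: k def_N => [|k] def_N; rewrite def_N in IHN *.
    exists (0, 0); split=> // c; split=> [[i <-]|]; first by rewrite changes0.
    by case: c => // _; exists 0; rewrite changes0.
  have [|b /range_double bP] := IHN k.+1; first lia.
  by exists (k.+1.*2 - b.2, k.+1.*2 - b.1).
case: k def_N => [|k] def_N; rewrite def_N in IHN *.
  exists (0, 1); split=> // c; split=> [[i <-]|].
    by rewrite changesS changes0; case: (change _).
  have ch0 : change 0 by exact: (change_double 0).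
  have ch1 : change 1 = false by rewrite (change_doubleS 0) ch0.
  case: c => [|[|c]] // _.
    by exists 1; rewrite changesS changes0 ch1.
  by exists 0; rewrite changesS changes0 ch0.
have [|b bP] := IHN k.+1; first lia.
have [|b' bP'] := IHN k.+2; first lia.
by eexists; apply: range_doubleS bP bP'.
Qed.

Definition range N := sval (cid (range_exists N)).
Definition lo N := (range N).1.
Definition hi N := (range N).2.

Lemma rangeP N : is_range N (lo N, hi N).
Proof. by rewrite -surjective_pairing; apply: svalP. Qed.

Lemma range_unique N l h : is_range N (l, h) -> lo N = l /\ hi N = h.
Proof.
move=> [/= le_lh P]; have [/= le_LH P'] := rangeP N.
have same c : l <= c <= h <-> lo N <= c <= hi N.
  by split=> [/P/P'|/P'/P].
have := (same l).1; have := (same h).1; have := (same (lo N)).2.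
have := (same (hi N)).2; lia.
Qed.

Lemma lo_hi_double N :
  lo N.*2 = N.*2 - hi N /\ hi N.*2 = N.*2 - lo N.
Proof. exact/range_unique/range_double/rangeP. Qed.

Lemma lo_hi_doubleS N :
  lo N.*2.+1 = N.*2.+1 - hi N.+1 /\ hi N.*2.+1 = N.*2.+1 - lo N.
Proof. exact/range_unique/(range_doubleS (rangeP _) (rangeP _)). Qed.

Lemma lo_le_hi N : lo N <= hi N <= N.
Proof. by have := range_le (rangeP N); have [] := rangeP N => /=; lia. Qed.

(** * The complexity in terms of ranges *)

Definition segment l h := iota l (h.+1 - l).

Lemma mem_segment l h c : (c \in segment l h) = (l <= c <= h).
Proof. by rewrite mem_iota; lia. Qed.

Lemma count_odd_segment p l h : l <= h ->
  2 * count (fun c => odd (c + p)) (segment l h) =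
  h - l + odd (l + p) + odd (h + p).
Proof.
move/subnKC <-; rewrite /segment -addnS !addKn.
elim: (h - l) => [|d IHd]; first by rewrite addn0 /=; lia.
rewrite -[in iota _ _]addn1 iotaD count_cat mulnDr IHd /= !addnS /=.
by case: (odd (l + d + p)); lia.
Qed.

Lemma count_even_segment p l h : l <= h ->
  2 * count (fun c => ~~ odd (c + p)) (segment l h)
    + odd (l + p) + odd (h + p) = (h - l).+2.
Proof.
move=> le_lh; have := count_odd_segment p le_lh.
have : count (fun c => odd (c + p)) (segment l h) +
       count (fun c => ~~ odd (c + p)) (segment l h) = size (segment l h).
  exact: count_predC.
by rewrite size_iota; lia.
Qed.

Lemma oddE_complement M c : c <= M -> odd (M - c + M) = odd c.
Proof. by lia. Qed.

Lemma count_odd_complement M l h : l <= h <= M ->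
  2 * count (fun c => odd (c + M)) (segment (M - h) (M - l)) =
  h - l + odd l + odd h.
Proof.
move=> le_lhM; rewrite count_odd_segment; last lia.
rewrite !oddE_complement; lia.
Qed.

Lemma count_even_complement M l h : l <= h <= M ->
  2 * count (fun c => ~~ odd (c + M)) (segment (M - h) (M - l))
    + odd l + odd h = (h - l).+2.
Proof.
move=> le_lhM; have := @count_even_segment M (M - h) (M - l).
rewrite !oddE_complement; lia.
Qed.

(** For factors of length 2k+1, with 2k pairs of consecutive letters, both
    parities of the position attain the same numbers of changes, the reflection
    of the range for k. *)
Lemma complexity_odd k :
  abelian2_complexity thue_morse k.*2.+1 + 3 * lo k =
  3 * hi k + 2 + odd (lo k) + odd (hi k).
Proof.
rewrite (@complexity_count _ (segment (lo k.*2) (hi k.*2))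
  (segment (lo k.*2) (hi k.*2)) (segment (lo k.*2) (hi k.*2))) ?iota_uniq //.
- have le_k : lo k <= hi k <= k.*2 by have := lo_le_hi k; lia.
  have := count_odd_complement le_k; have := count_even_complement le_k.
  by have [-> ->] := lo_hi_double k; lia.
- by move=> c; rewrite mem_segment; have [_ <-] := rangeP k.*2.
- move=> c; rewrite mem_segment; have [-> ->] := lo_hi_double k.
  by rewrite (range_complement (rangeP k) (changes_double ^~ k)).2.
- move=> c; rewrite mem_segment; have [-> ->] := lo_hi_double k.
  by rewrite (range_complement (rangeP k) (changes_doubleS ^~ k)).2.
Qed.

(** For factors of length 2k+2, with 2k+1 pairs of consecutive letters, even
    positions reflect the range for k and odd positions the range for k+1. *)
Lemma complexity_even k :
  abelian2_complexity thue_morse k.+1.*2 + (lo k).*2 + lo k.+1 =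
  hi k + (hi k.+1).*2 + 2 + odd (hi k) + odd (lo k.+1).
Proof.
have [le_k le_k1] := (lo_le_hi k, lo_le_hi k.+1).
have [le_M evenP] := range_complement (rangeP k) (changes_double_odd ^~ k).
have [le_M' oddP] := range_complement (rangeP k.+1) (changes_doubleS_odd ^~ k).
have step := range_step (rangeP k) (rangeP k.+1); rewrite /= in le_M le_M' step.
set N := k.*2.+1 in le_M le_M' evenP oddP *.
rewrite doubleS (@complexity_count N (segment (N - hi k.+1) (N - lo k))
  (segment (N - hi k) (N - lo k))
  (segment (N - hi k.+1) (N - lo k.+1))) ?iota_uniq //.
- have := @count_even_complement N (lo k) (hi k.+1).
  have := @count_odd_complement N (lo k) (hi k).
  have := @count_odd_complement N (lo k.+1) (hi k.+1).
  by clearbody N; lia.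
- move=> c; rewrite mem_segment.
  by have [_ <-] := range_doubleS (rangeP k) (rangeP k.+1).
- by move=> c; rewrite mem_segment evenP.
- by move=> c; rewrite mem_segment oddP.
Qed.

(** * Linear recurrences *)

Local Open Scope ring_scope.
Local Open Scope classical_set_scope.

Definition complexity n : int := Posz (abelian2_complexity thue_morse n).

(** These four sequences, with the shifts to n+1 of all but [cross], are what
    the substitutions n -> 2n and n -> 2n+1 exchange up to constants. *)
Definition spread n : int := (hi n)%:Z - (lo n)%:Z.
Definition cross n : int := (hi n.+1)%:Z - (lo n)%:Z.
Definition lo_odd n : int := odd (lo n).
Definition hi_odd n : int := odd (hi n).

Lemma spread_double n : spread n.*2 = spread n.
Proof.
by have [lo2 hi2] := lo_hi_double n; have := lo_le_hi n; rewrite /spread; lia.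
Qed.

Lemma spread_doubleS n : spread n.*2.+1 = cross n.
Proof.
have [lo2 hi2] := lo_hi_doubleS n.
by have := lo_le_hi n; have := lo_le_hi n.+1; rewrite /spread /cross; lia.
Qed.

Lemma cross_double n : cross n.*2 = spread n + 1.
Proof.
have [[lo1 hi1] [lo2 hi2]] := (lo_hi_double n, lo_hi_doubleS n).
by have := lo_le_hi n; rewrite /spread /cross; lia.
Qed.

Lemma cross_doubleS n : cross n.*2.+1 = spread n.+1 + 1.
Proof.
have [[lo1 hi1] [lo2 hi2]] := (lo_hi_double n.+1, lo_hi_doubleS n).
by have := lo_le_hi n.+1; rewrite /spread /cross -doubleS; lia.
Qed.

Lemma lo_odd_double n : lo_odd n.*2 = hi_odd n.
Proof.
have [lo2 hi2] := lo_hi_double n; have := lo_le_hi n.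
by rewrite /lo_odd /hi_odd; lia.
Qed.

Lemma hi_odd_double n : hi_odd n.*2 = lo_odd n.
Proof.
have [lo2 hi2] := lo_hi_double n; have := lo_le_hi n.
by rewrite /lo_odd /hi_odd; lia.
Qed.

Lemma lo_odd_doubleS n : lo_odd n.*2.+1 = 1 - hi_odd n.+1.
Proof.
have [lo2 hi2] := lo_hi_doubleS n; have := lo_le_hi n.+1.
have := range_le (rangeP n.+1); rewrite /lo_odd /hi_odd; lia.
Qed.

Lemma hi_odd_doubleS n : hi_odd n.*2.+1 = 1 - lo_odd n.
Proof.
have [lo2 hi2] := lo_hi_doubleS n; have := lo_le_hi n.
by rewrite /lo_odd /hi_odd; lia.
Qed.

Definition range_doubleE := (spread_double, spread_doubleS, cross_double,
  cross_doubleS, lo_odd_double, lo_odd_doubleS, hi_odd_double, hi_odd_doubleS).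

Lemma complexity_doubleS k :
  complexity k.*2.+1 = 3 * spread k + 2 + lo_odd k + hi_odd k.
Proof.
have := complexity_odd k; rewrite /complexity /spread /lo_odd /hi_odd; lia.
Qed.

Lemma complexity_doubleSS k : complexity k.*2.+2 =
  cross k + spread k + spread k.+1 + 2 + hi_odd k + lo_odd k.+1.
Proof.
have := complexity_even k.
rewrite doubleS /complexity /cross /spread /lo_odd /hi_odd; lia.
Qed.

Definition decimation e c : nat -> int :=
  fun n => complexity (2 ^ e * n + c).

(** [binary m n c], for m a power of 2 and c < m, is m * n + c written by
    doublings and successors, the form in which the recurrences apply. *)
Ltac binary m n c :=
  lazymatch eval compute in m with
  | 1%N => constr:(n)
  | _ =>
    let h := eval compute in (m./2) in
    let d := eval compute in (c./2) in
    let t := binary h n d in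
    lazymatch eval compute in (odd c) with
    | true => constr:(t.*2.+1)
    | false => constr:(t.*2)
    end
  end.

(** An even index is written as 2k+2, since the recurrence there involves both
    k and k+1. *)
Ltac expand_complexity :=
  match goal with |- context [complexity (?m * ?n + ?c)] =>
    lazymatch eval compute in (odd c) with
    | true =>
      let t := binary m n c in
      rewrite (_ : m * n + c = t)%N; [rewrite complexity_doubleS|lia]
    | false =>
      let t := binary (m./2) n (c./2.-1) in
      rewrite (_ : m * n + c = t.*2.+2)%N; [rewrite complexity_doubleSS|lia]
    end
  end.

Ltac expand_recurrences :=
  repeat expand_complexity;
  repeat (rewrite range_doubleE || rewrite -doubleS); lia.

Ltac by_recurrences :=
  apply/funext => n; rewrite /decimation ?fctE ?natmulfctE; expand_recurrences.

(** The coefficients come from Gaussian elimination on initial values of the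
    sequences; once they are known, expanding both sides by the recurrences
    down to n and n+1 leaves a linear identity. *)
Lemma decimation_2_1 : decimation 2 1 =
  decimation 1 1.
Proof. by_recurrences. Qed.

Lemma decimation_3_3 : decimation 3 3 =
  decimation 2 2 + decimation 3 4 - decimation 2 3.
Proof. by_recurrences. Qed.

Lemma decimation_4_0 : decimation 4 0 =
  decimation 3 0.
Proof.
(* The index 0 is not of the form 2k+2; elsewhere, 16(n+1) and 8(n+1) are. *)
apply/funext => -[|n]; rewrite /decimation; first by rewrite !muln0.
by rewrite !mulnS !addn0 ![(2 ^ _ + _)%N]addnC; expand_recurrences.
Qed.

Lemma decimation_4_8 : decimation 4 8 =
  decimation 2 3 + decimation 3 2 - decimation 1 1.
Proof. by_recurrences. Qed.

Lemma decimation_4_12 : decimation 4 12 =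
  decimation 2 2 + decimation 3 2 *+ 2 + decimation 3 4 + decimation 3 7
    - decimation 1 1 *+ 2 - decimation 3 6 - decimation 4 4.
Proof. by_recurrences. Qed.

Lemma decimation_4_2 : decimation 4 2 =
  decimation 3 2.
Proof. by_recurrences. Qed.

Lemma decimation_4_10 : decimation 4 10 =
  decimation 2 3 + decimation 3 2 - decimation 1 1.
Proof. by_recurrences. Qed.

Lemma decimation_4_6 : decimation 4 6 =
  decimation 3 2 *+ 2 + decimation 3 4 *+ 2 - decimation 1 1 - decimation 2 3
    - decimation 4 4.
Proof. by_recurrences. Qed.

Lemma decimation_4_14 : decimation 4 14 =
  decimation 2 2 + decimation 2 3 + decimation 3 7 + decimation 4 4
    - decimation 1 1 - decimation 3 4 *+ 2.
Proof. by_recurrences. Qed.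

Lemma decimation_4_7 : decimation 4 7 =
  decimation 3 2 *+ 2 + decimation 3 4 *+ 2 - decimation 1 1 - decimation 2 2
    - decimation 4 4.
Proof. by_recurrences. Qed.

Lemma decimation_4_15 : decimation 4 15 =
  decimation 2 2 *+ 3 + decimation 2 3 *+ 3 + decimation 3 2
    + decimation 3 7 *+ 2 + decimation 4 4 - decimation 1 1 *+ 3
    - decimation 3 4 *+ 3 - decimation 3 6 *+ 3.
Proof. by_recurrences. Qed.

Lemma decimation_5_4 : decimation 5 4 =
  decimation 4 4.
Proof. by_recurrences. Qed.

Lemma decimation_5_20 : decimation 5 20 =
  decimation 3 2 *+ 3 + decimation 3 4 *+ 3 - decimation 1 1 *+ 2
    - decimation 2 3 - decimation 4 4 *+ 2.
Proof. by_recurrences. Qed.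

Definition decimation_relations := (decimation_2_1, decimation_3_3,
  decimation_4_0, decimation_4_8, decimation_4_12, decimation_4_2,
  decimation_4_10, decimation_4_6, decimation_4_14, decimation_4_7,
  decimation_4_15, decimation_5_4, decimation_5_20).

(** * Regularity from a finite generating set *)

Lemma zmod_generated_closed (V : zmodType) (G : set V) :
  zmod_closed (fun x => x \in zmod_generated G).
Proof.
split=> [|x y].
  by apply/mem_set => A [[A0 _] _]; exact: set_mem A0.
move=> /set_mem Gx /set_mem Gy; apply/mem_set => A clA.
by have [[_ AB] _] := clA; apply/set_mem/AB; apply/mem_set;
  [apply: Gx|apply: Gy].
Qed.

Lemma zmod_generatedB (V : zmodType) (G : set V) x y :
  zmod_generated G x -> zmod_generated G y -> zmod_generated G (x - y).
Proof.
move=> Gx Gy; have [_ GB] := zmod_generated_closed G.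
by apply/set_mem/GB; apply/mem_set.
Qed.

Lemma zmod_generatedD (V : zmodType) (G : set V) x y :
  zmod_generated G x -> zmod_generated G y -> zmod_generated G (x + y).
Proof.
move=> Gx Gy; rewrite -[y]opprK; apply: zmod_generatedB => //.
rewrite -[- y]sub0r.
apply: zmod_generatedB => //; apply/set_mem.
by have [] := zmod_generated_closed G.
Qed.

Lemma zmod_generatedMn (V : zmodType) (G : set V) x n :
  zmod_generated G x -> zmod_generated G (x *+ n).
Proof.
move=> Gx; elim: n => [|n IHn]; last by rewrite mulrS; apply: zmod_generatedD.
by rewrite mulr0n -(subrr x); apply: zmod_generatedB.
Qed.

Lemma zmod_generated_sub (V : zmodType) (G H : set V) :
  G `<=` zmod_generated H -> zmod_generated G `<=` zmod_generated H.
Proof. by apply: smallest_sub; apply: zmod_generated_closed. Qed.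

(** The decimation at k^(e+1) n + c is the decimation at k n + (c / k^e) of the
    one at k^e n + (c mod k^e), so a subgroup stable under the k decimations
    of first order that contains [a] contains the whole kernel. *)
Lemma regular_of_generators k (a : nat -> int) (B : set (nat -> int)) :
  (0 < k)%N -> finite_set B -> B `<=` kernel k a -> B a ->
  (forall b r, B b -> (r < k)%N ->
     zmod_generated B (fun n => b (k * n + r)%N)) ->
  regular k a.
Proof.
move=> k_gt0 finB subB Ba decB; exists B => //; apply/seteqP; split; last first.
  by apply: zmod_generated_sub => b /subB; apply: sub_gen_smallest.
have {}decB r : (r < k)%N -> forall b, zmod_generated B b ->
    zmod_generated B (fun n => b (k * n + r)%N).
  move=> lt_r; apply: (@smallest_sub _ _ _
    [set b | zmod_generated B (fun n => b (k * n + r)%N)]) => [|b Bb];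
    last exact: decB.
  split=> [|x y /set_mem Bx /set_mem By]; apply/mem_set.
    by apply/set_mem; have [] := zmod_generated_closed B.
  exact: (zmod_generatedB Bx By).
apply: zmod_generated_sub => _ [e [c [lt_c ->]]].
elim: e c lt_c => [|e IHe] c lt_c.
  have -> : (fun n => a (k ^ 0 * n + c)%N) = a.
    apply/funext => n; rewrite expn0 mul1n.
    by case: c lt_c => // _; rewrite addn0.
  exact: sub_gen_smallest.
have ke_gt0 : (0 < k ^ e)%N by rewrite expn_gt0 k_gt0.
have lt_div : (c %/ k ^ e < k)%N by rewrite ltn_divLR // -expnS.
have := decB _ lt_div _ (IHe _ (ltn_pmod c ke_gt0)).
congr (zmod_generated B _); apply/funext => n; congr a.
by rewrite mulnDr mulnA -expnSr -addnA [(k ^ e * (c %/ _))%N]mulnC -divn_eq.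
Qed.

(** * Generators of the 2-kernel *)

Definition generator_indices : seq (nat * nat) :=
  [:: (0, 0); (1, 0); (1, 1); (2, 0); (2, 2); (2, 3);
      (3, 0); (3, 2); (3, 4); (3, 6); (3, 7); (4, 4)]%N.

Definition generators : set (nat -> int) :=
  [set decimation p.1 p.2 | p in [set` generator_indices]].

Lemma generators_mem e c : (e, c) \in generator_indices ->
  zmod_generated generators (decimation e c).
Proof. by move=> mem_ec; apply: sub_gen_smallest; exists (e, c). Qed.

Ltac normalize_offset :=
  match goal with |- zmod_generated _ (decimation ?e ?c) =>
    let d := eval compute in c in change c with d
  end.

Ltac in_span :=
  repeat (apply: zmod_generatedB || apply: zmod_generatedD ||
          apply: zmod_generatedMn); exact: generators_mem.

(** Each of the 24 children is a generator or the left-hand side of a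
    relation. *)
Lemma decimation_children e c r : (e, c) \in generator_indices -> (r < 2)%N ->
  zmod_generated generators (decimation e.+1 (2 ^ e * r + c)).
Proof.
rewrite !inE !xpair_eqE => mem_ec; case: r => [|[|//]] _; move: mem_ec;
  do ?[case/orP]; case/andP=> /eqP-> /eqP->; normalize_offset;
  rewrite ?decimation_relations; in_span.
Qed.

Local Close Scope ring_scope.
Local Close Scope classical_set_scope.

Theorem theorem1p1 :
  regular 2 (fun n : nat => Posz (abelian2_complexity thue_morse n)).
Proof.
have dec0 : decimation 0 0 = complexity.
  by apply/funext => n; rewrite /decimation expn0 mul1n addn0.
apply: (@regular_of_generators _ _ generators) => //.
- exact/finite_image/finite_seq.
- move=> _ [[e c] /= mem_ec <-]; exists e, c; split=> //.
  have /allP/(_ _ mem_ec) // :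
    all (fun p => p.2 < 2 ^ p.1) generator_indices by [].
- by exists (0, 0).
- move=> _ r [[e c] /= mem_ec <-] lt_r.
  have := decimation_children mem_ec lt_r; congr (zmod_generated _ _).
  apply/funext => n; rewrite /decimation expnSr mulnDr; congr complexity; lia.
Qed.
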